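(* Let $(X_n)$ be a sequence of finite sets and let $(\mathcal{F}_n)$ be a sequence of nontrivial upper sets $\mathcal{F}_n \subseteq 2^{X_n}$. Let $K>0$ be a constant such that $p_c(\mathcal{F}_n)\leq K q(\mathcal{F}_n)\log \ell(\mathcal{F}_n)$ for all $n$. If $\ell(\mathcal{F}_n)\to\infty$ and the Kahn-Kalai bounds provide nontrivial information for $(\mathcal{F}_n)$, then $|(\mathcal{F}_n)_0|\to\infty$.
   Context: For a finite set $X$, an upper set is a subset $\mathcal{F}\subseteq 2^X$ such that $A\in\mathcal{F}$ and $A\subseteq B\subseteq X$ imply $B\in\mathcal{F}$; it is nontrivial if $\mathcal{F}\neq\emptyset$ and $\mathcal{F}\neq 2^X$. For $p\in[0,1]$ let $\mu_p(\mathcal{F})=\sum_{S\in\mathcal{F}}p^{|S|}(1-p)^{|X|-|S|}$; for nontrivial $\mathcal{F}$, the critical probability $p_c(\mathcal{F})$ is the unique $p\in[0,1]$ with $\mu_p(\mathcal{F})=\frac12$. For $S\subseteq X$ let $\langle S\rangle=\{T\subseteq X: S\subseteq T\}$. A set $\mathcal{G}\subseteq 2^X$ is a cover of $\mathcal{F}$ if $\mathcal{F}\subseteq\bigcup_{S\in\mathcal{G}}\langle S\rangle$. $\mathcal{F}$ is $p$-small if it has a cover $\mathcal{G}$ with $\sum_{S\in\mathcal{G}}p^{|S|}\leq\frac12$. The expectation threshold $q(\mathcal{F})$ is the largest $p\in[0,1]$ for which $\mathcal{F}$ is $p$-small. $\mathcal{F}_0$ denotes the set of (inclusion-)minimal elements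 of $\mathcal{F}$ (so $(\mathcal{F}_n)_0$ is the set of minimal elements of $\mathcal{F}_n$), $\ell_0(\mathcal{F})=\max\{|S|:S\in\mathcal{F}_0\}$ and $\ell(\mathcal{F})=\max\{\ell_0(\mathcal{F}),2\}$. $\log$ is the logarithm to base 2. The Kahn-Kalai bounds provide nontrivial information for $(\mathcal{F}_n)$ if there exists $N$ such that $Kq(\mathcal{F}_n)\log\ell(\mathcal{F}_n)<1$ for all $n\geq N$. *)

(* Defs.v *)
From HB Require Import structures.
From mathcomp Require Import all_boot all_order all_algebra.
From mathcomp Require Import all_classical all_reals all_analysis.

Set Implicit Arguments.
Unset Strict Implicit.
Unset Printing Implicit Defensive.

Import Order.TTheory GRing.Theory Num.Theory.
Import numFieldNormedType.Exports.

Local Open Scope ring_scope.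

(* classical_sets shadows several finset notations: %SET and finset.set0      *)
(* denote finite sets, %classic the sets of reals.                            *)

Definition upper_set (X : finType) (F : {set {set X}}) : Prop :=
  forall A B : {set X}, A \in F -> A \subset B -> B \in F.

Definition nontrivial (X : finType) (F : {set {set X}}) : Prop :=
  F <> finset.set0 /\ F <> [set: {set X}]%SET.

Definition mu (R : realType) (X : finType) (p : R) (F : {set {set X}}) : R :=
  \sum_(S in F) p ^+ #|S| * (1 - p) ^+ (#|X| - #|S|).

Definition critical_set (R : realType) (X : finType) (F : {set {set X}}) :
    set R :=
  [set p : R | 0 <= p <= 1 /\ mu p F = 2^-1]%classic.
Arguments critical_set R {X} F.

(* The default value 0 is irrelevant for nontrivial upper sets: by            *)
(* critical_probabilityP and critical_set_unique, critical_set is then a      *)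
(* singleton.                                                                 *)
Definition critical_probability (R : realType) (X : finType)
    (F : {set {set X}}) : R :=
  xget 0 (critical_set R F).

Definition principal (X : finType) (S : {set X}) : {set {set X}} :=
  [set T : {set X} | S \subset T]%SET.

Definition is_cover (X : finType) (G F : {set {set X}}) : Prop :=
  F \subset (\bigcup_(S in G) principal S)%SET.

Definition p_small (R : realType) (X : finType) (p : R) (F : {set {set X}}) :
    Prop :=
  exists2 G : {set {set X}}, is_cover G F & \sum_(S in G) p ^+ #|S| <= 2^-1.

Definition small_set (R : realType) (X : finType) (F : {set {set X}}) : set R :=
  [set p : R | 0 <= p <= 1 /\ p_small p F]%classic.
Arguments small_set R {X} F.

(* The largest element of small_set; it exists for nontrivial upper sets by   *)
(* expectation_thresholdP, so that the default value 0 is irrelevant.         *)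
Definition expectation_threshold (R : realType) (X : finType)
    (F : {set {set X}}) : R :=
  xget 0 (small_set R F `&` ubound (small_set R F))%classic.

Definition minimal_elements (X : finType) (F : {set {set X}}) : {set {set X}} :=
  [set S : {set X} | minset (fun T => T \in F) S]%SET.

Definition ell0 (X : finType) (F : {set {set X}}) : nat :=
  \max_(S in minimal_elements F) #|S|.

Definition ell (X : finType) (F : {set {set X}}) : nat := maxn (ell0 F) 2.

Definition log2 (R : realType) (x : R) : R := ln x / ln 2.

Definition kahn_kalai_bound (R : realType) (K : R) (X : finType)
    (F : {set {set X}}) : R :=
  K * expectation_threshold R F * log2 (ell F)%:R.

Definition nontrivial_information (R : realType) (K : R) (X : nat -> finType)
    (F : forall n, {set {set X n}}) : Prop :=
  exists N : nat, forall n : nat, (N <= n)%N -> kahn_kalai_bound K (F n) < 1.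

Section WellDefined.
Variables (R : realType) (X : finType).
Implicit Types (F G : {set {set X}}) (S T : {set X}) (p q : R).

Lemma nontrivial_upper F : upper_set F -> nontrivial F ->
  finset.set0 \notin F /\ [set: X]%SET \in F.
Proof.
move=> upF [F0 FT]; split.
  apply/negP => F0'; apply: FT; apply/finset.setP => S.
  by rewrite inE (upF _ _ F0' (finset.sub0set _)).
have /set0Pn[S SF] : F != finset.set0 by apply/eqP.
exact: upF SF (finset.subsetT _).
Qed.

Let wt p (b : bool) : R := if b then p else 1 - p.

Lemma weight_prod p S :
  p ^+ #|S| * (1 - p) ^+ (#|X| - #|S|) = \prod_(i : X) wt p (i \in S).
Proof.
rewrite (bigID (fun i => i \in S)) /=; congr (_ * _).
  rewrite (eq_bigr (fun=> p)) ?prodr_const // => i iS.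
  by rewrite /wt iS.
rewrite -(finset.setCK S) -cardsCs finset.setCK -prodr_const.
rewrite (eq_bigl (fun i => i \notin S)) => [|i].
  by apply: eq_bigr => i /negbTE iS; rewrite /wt iS.
by rewrite inE.
Qed.

(* mu p F as the probability that a product measure assigns to F, where p is  *)
(* the law of g under the weight w.                                           *)
Lemma mu_coupling p (C : finType) (w : C -> R) (g : C -> bool) F :
  (forall b, \sum_(c | g c == b) w c = wt p b) ->
  mu p F = \sum_(f : {ffun X -> C} | [set i | g (f i)]%SET \in F)
             \prod_i w (f i).
Proof.
move=> gw; rewrite (partition_big (fun f : {ffun X -> C} => [set i | g (f i)]%SET)
                       (fun S => S \in F)) //=.
apply: eq_bigr => S SF; rewrite weight_prod.
under eq_bigr do rewrite -gw.
rewrite bigA_distr_big_dep; apply: eq_bigl => f.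
apply/familyP/andP => [fS|[_ /eqP <-] i]; last by apply/eqP; rewrite finset.in_set.
have -> : [set i | g (f i)]%SET = S.
  by apply/finset.setP => i; rewrite finset.in_set; apply/eqP/(fS i).
by rewrite SF eqxx.
Qed.

Lemma mu_lt F p q : upper_set F -> nontrivial F ->
  0 <= p -> p < q -> q <= 1 -> mu p F < mu q F.
Proof.
move=> upF /(nontrivial_upper upF)[F0 FT] p0 pq q1.
have q0 : 0 < q by exact: le_lt_trans pq.
pose r := p / q.
have r1 : r < 1 by rewrite ltr_pdivrMr ?mul1r.
have r0 : 0 <= r by rewrite divr_ge0 // ltW.
have qr : q * r = p by rewrite /r mulrC divfK // gt_eqF.
pose w (c : bool * bool) := wt q c.1 * wt r c.2.
have w0 c : 0 <= w c.
  by case: c => [[] []]; rewrite /w /wt /= mulr_ge0 ?subr_ge0 // ltW.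
have big4 (P : pred (bool * bool)) : \sum_(c | P c) w c =
    (if P (true, true) then w (true, true) else 0)
  + (if P (true, false) then w (true, false) else 0)
  + ((if P (false, true) then w (false, true) else 0)
  + (if P (false, false) then w (false, false) else 0)).
  transitivity (\sum_a \sum_b if P (a, b) then w (a, b) else 0).
    by rewrite big_mkcond pair_bigA; apply: eq_bigr => -[].
  by rewrite !big_bool.
rewrite (@mu_coupling p _ w (fun c => c.1 && c.2)); last first.
  move=> b; rewrite big4 /w /wt /=; case: b => /=.
    by rewrite !addr0.
  rewrite add0r -qr.
  rewrite -mulrDr addrC [r + _]addrC subrK mulr1.
  by rewrite mulrBr mulr1 addrA subrK.
rewrite (@mu_coupling q _ w (fun c => c.1)); last first.
  move=> b; rewrite big4 /w /wt /=; case: b => /=.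
    by rewrite !addr0 -mulrDr [r + _]addrC subrK mulr1.
  by rewrite !add0r -mulrDr [r + _]addrC subrK mulr1.
pose f0 : {ffun X -> bool * bool} := [ffun=> (true, false)].
have f01 : [set i | (f0 i).1]%SET \in F.
  rewrite (_ : [set i | _]%SET = [set: X]%SET) //.
  by apply/finset.setP => i; rewrite !inE ffunE.
have f02 : [set i | (f0 i).1 && (f0 i).2]%SET \notin F.
  rewrite (_ : [set i | _]%SET = finset.set0) //.
  by apply/finset.setP => i; rewrite !inE ffunE.
rewrite [ltRHS](bigD1 f0) //= big_mkcond [X in _ < _ + X]big_mkcond /=.
apply: ltr_pwDl.
  apply: prodr_gt0 => i _; rewrite ffunE /w /wt /=.
  by rewrite mulr_gt0 // subr_gt0.
apply: ler_sum => f _.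
have W0 : 0 <= \prod_i w (f i) by apply: prodr_ge0.
case: ifPn => [fF|_]; last by case: ifP.
rewrite ifT //; apply/andP; split; last first.
  by apply: contraNneq f02 => <-.
apply: upF fF _; apply/fintype.subsetP => i; rewrite !finset.in_set.
by case/andP.
Qed.

Lemma critical_set_unique F p q : upper_set F -> nontrivial F ->
  critical_set R F p -> critical_set R F q -> p = q.
Proof.
move=> upF ntF [/andP[p0 p1] mp] [/andP[q0 q1] mq].
case: (ltgtP p q) => // pq.
  by have := mu_lt upF ntF p0 pq q1; rewrite mp mq ltxx.
by have := mu_lt upF ntF q0 pq p1; rewrite mp mq ltxx.
Qed.

Lemma critical_probabilityP F : upper_set F -> nontrivial F ->
  critical_set R F (critical_probability R F).
Proof.
move=> upF ntF; have [F0 FT] := nontrivial_upper upF ntF.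
apply: xgetPex.
pose P : {poly R} :=
  \sum_(S in F) 'X ^+ #|S| * (1 - 'X) ^+ (#|X| - #|S|) - (2^-1)%:P.
have PE p : P.[p] = mu p F - 2^-1.
  rewrite /P hornerD hornerN hornerC horner_sum; congr (_ - _).
  by apply: eq_bigr => S _; rewrite hornerM !horner_exp
    hornerD hornerN hornerX hornerC.
have m0 : mu (0 : R) F = 0.
  rewrite /mu big1 // => S SF; rewrite expr0n finset.cards_eq0.
  have /negbTE-> : S != finset.set0; rewrite ?mul0r //.
  by apply: contraNneq F0 => <-.
have m1 : mu (1 : R) F = 1.
  rewrite /mu (bigD1 [set: X]%SET) //= big1 ?addr0.
    by rewrite cardsT subnn expr0 expr1n mulr1.
  move=> S /andP[_ ST]; rewrite subrr expr0n subn_eq0 -cardsT.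
  have := finset.eqEcard S [set: X]%SET; rewrite finset.subsetT (negbTE ST).
  by move=> /= <-; rewrite mulr0.
have [||p p01 /rootP] := @poly_ivt _ P 0 1.
  - exact: ler01.
  - by rewrite !PE m0 m1 sub0r oppr_le0 invr_ge0
       ler0n subr_ge0 invf_le1 ?ler1n // ltr0n.
by rewrite PE => /eqP; rewrite subr_eq0 => /eqP mp; exists p.
Qed.

Lemma expectation_thresholdP F : upper_set F -> nontrivial F ->
  (small_set R F `&` ubound (small_set R F))%classic
    (expectation_threshold R F).
Proof.
move=> upF ntF; have [F0 FT] := nontrivial_upper upF ntF.
apply: xgetPex.
have A0 : small_set R F 0.
  split; first by rewrite lexx ler01.
  exists F.
    apply/fintype.subsetP => S SF; apply/bigcupP; exists S => //.
    by rewrite inE.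
  rewrite big1 ?invr_ge0 // => S SF; rewrite expr0n finset.cards_eq0.
  by have /negbTE-> : S != finset.set0 by apply: contraNneq F0 => <-.
have Aub : ubound (small_set R F) 1 by move=> p [/andP[]].
have supA : has_sup (small_set R F) by split; [exists 0 | exists 1].
pose s := sup (small_set R F).
have sub : ubound (small_set R F) s by exact/ubP/sup_upper_bound.
exists s; split=> //; split.
  by rewrite (sub _ A0) /= ge_sup //; exists 0.
apply: contrapT => nsm.
pose P (G : {set {set X}}) : {poly R} := \sum_(S in G) 'X ^+ #|S|.
have PE G p : (P G).[p] = \sum_(S in G) p ^+ #|S|.
  by rewrite horner_sum; apply: eq_bigr => S _; rewrite horner_exp hornerX.
have : \forall p \near s, forall G,
    is_cover G F -> 2^-1 < \sum_(S in G) p ^+ #|S|.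
  apply: (@filter_forall _ _
    (fun G p => is_cover G F -> 2^-1 < \sum_(S in G) p ^+ #|S|)
    _ (nbhs_filter s)) => G.
  have [cG|ncG] := boolP (F \subset (\bigcup_(S in G) principal S)%SET); last first.
    by near=> p; rewrite /is_cover (negbTE ncG).
  have Gs : 2^-1 < (P G).[s].
    rewrite PE ltNge; apply/negP => Gs; apply: nsm.
    by exists G.
  have := @continuous_horner _ (P G) s.
  move=> /cvgr_gt /(_ _ Gs).
  by apply: filterS => p; rewrite PE.
move=> /nbhs_ballP[e /= e0 He].
have [p Ap ps] := sup_adherent e0 supA.
have [_ [G cG]] := Ap; apply/negP; rewrite -ltNge.
apply: He cG; rewrite /ball /= ger0_norm ?subr_ge0 ?sub //.
by rewrite ltrBlDr addrC -ltrBlDr.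
Unshelve. all: by end_near. Qed.

End WellDefined.

(* Main.v *)
(** Every minimal element of a nontrivial upper set is nonempty, and the minimal
    elements form a cover; with m of them this cover has cost at most m p, so
    q >= 1 / (2 m). If moreover K q log2 ell < 1, then K log2 ell < 2 m, and m
    tends to infinity with ell. *)
Require Import Defs.
From mathcomp Require Import all_boot all_order all_algebra.
From mathcomp Require Import all_classical all_reals all_analysis.
Import Order.TTheory GRing.Theory Num.Theory.
Import numFieldNormedType.Exports.
Local Open Scope classical_set_scope.
Local Open Scope ring_scope.

Lemma minimal_elements_cover (X : finType) (F : {set {set X}}) :
  is_cover (minimal_elements F) F.
Proof.
apply/fintype.subsetP => S SF.
have [T minT TS] := @minset_exists _ (fun T => T \in F) S SF.
by apply/bigcupP; exists T; rewrite inE.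
Qed.

Lemma card_minimal_elements_gt0 (X : finType) (F : {set {set X}}) :
  nontrivial F -> (0 < #|minimal_elements F|)%N.
Proof.
move=> [F0 _]; have /set0Pn[S SF] : F != finset.set0 by exact/eqP.
have /fintype.subsetP/(_ S SF)/bigcupP[T TF _] := minimal_elements_cover X F.
by apply/card_gt0P; exists T.
Qed.

(** If the empty set belonged to [F], upward closure would make [F] the whole power set. *)
Lemma minimal_element_size (X : finType) (F : {set {set X}}) (S : {set X}) :
  upper_set F -> nontrivial F -> S \in minimal_elements F -> (0 < #|S|)%N.
Proof.
move=> upF ntF; rewrite inE => /minsetp SF.
have [F0 _] := nontrivial_upper upF ntF.
by rewrite lt0n finset.cards_eq0; apply: contraNneq F0 => <-.
Qed.

Lemma expectation_threshold_ge (R : realType) (X : finType)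
    (F : {set {set X}}) :
  upper_set F -> nontrivial F ->
  (2 * #|minimal_elements F|%:R)^-1 <= expectation_threshold R F.
Proof.
move=> upF ntF; set m := #|_|.
have m_gt0 : (0 < m)%N by exact: card_minimal_elements_gt0.
have mR : 0 < m%:R :> R by rewrite ltr0n.
have p0 : 0 <= (2 * m%:R : R)^-1 by rewrite invr_ge0 mulr_ge0.
have p1 : (2 * m%:R : R)^-1 <= 1.
  by rewrite invf_le1 ?mulr_gt0 // -natrM ler1n muln_gt0.
(* The threshold bounds every p at which [F] is p-small, so a cheap cover at p = 1/(2m) suffices. *)
have [_ ub] := expectation_thresholdP R upF ntF.
apply: ub; split; first exact/andP.
exists (minimal_elements F); first exact: minimal_elements_cover.
apply: (@le_trans _ _ (\sum_(S in minimal_elements F) (2 * m%:R)^-1)).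
  apply: ler_sum => S /(minimal_element_size _ _ _ upF ntF) S0.
  (* As 0 <= p <= 1 and |S| >= 1, p^|S| <= p; the m terms then add up to at most 1/2. *)
  by rewrite -[leRHS]expr1 ler_wiXn2l.
by rewrite sumr_const -/m -[leLHS]mulr_natr invfM mulfVK ?gt_eqF.
Qed.

Lemma kahn_kalai_minimal_elements (R : realType) (K : R) (X : finType)
    (F : {set {set X}}) :
  upper_set F -> nontrivial F -> 0 < K -> kahn_kalai_bound K F < 1 ->
  K * log2 (ell F)%:R < 2 * #|minimal_elements F|%:R :> R.
Proof.
move=> upF ntF K0; rewrite /kahn_kalai_bound => bound.
have m0 : 0 < 2 * #|minimal_elements F|%:R :> R.
  by rewrite mulr_gt0 // ltr0n card_minimal_elements_gt0.
(* The maximum with 2 in [ell] keeps the argument of the logarithm above 1. *)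
have log0 : 0 <= log2 (ell F)%:R :> R.
  by rewrite divr_ge0 // ln_ge0 // ler1n // (leq_trans _ (leq_maxr _ _)).
(* Divided by 2m, the left side is the Kahn-Kalai bound with q replaced by its lower bound
   1/(2m). *)
rewrite -[ltRHS]mul1r -ltr_pdivrMr //; apply: le_lt_trans bound.
rewrite mulrAC; apply: ler_wpM2r => //.
by apply: ler_wpM2l; [exact: ltW|exact: expectation_threshold_ge].
Qed.

Theorem corollary5p6 (R : realType) (X : nat -> finType)
    (F : forall n : nat, {set {set X n}})
    (upF : forall n : nat, upper_set (F n))
    (ntF : forall n : nat, nontrivial (F n))
    (K : R) (K_gt0 : 0 < K)
    (KK : forall n : nat, critical_probability R (F n) <= kahn_kalai_bound K (F n))
    (ell_oo : (fun n : nat => ell (F n)) @ \oo --> \oo)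
    (ntI : nontrivial_information K F) :
  (fun n : nat => #|minimal_elements (F n)|) @ \oo --> \oo.
Proof.
apply/cvgnyPge => A.
(* Chosen so that [ell (F n)] exceeds [expR c] exactly when [K * log2 (ell (F n))] exceeds 2A. *)
pose c : R := 2 * A%:R / K * ln 2.
have ln2 : 0 < ln 2 :> R by rewrite ln_gt0 // ltr1n.
have [N bound] := ntI.
near=> n.
have ellc : expR c < (ell (F n))%:R.
  (* The divergence of [ell] is over the naturals, so [expR c] is rounded up to the successor of its
     integer part. *)
  apply: lt_le_trans (truncnS_gt (expR c)) _; rewrite ler_nat.
  by near: n; move/cvgnyPge: ell_oo; apply.
have bn : kahn_kalai_bound K (F n) < 1.
  by apply: bound; near: n; exact: nbhs_infty_ge.
(* What remains is the chain 2A < K log2 ell < 2m, which gives A < m. *)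
have := kahn_kalai_minimal_elements _ _ _ _ (upF n) (ntF n) K_gt0 bn.
move=> /(lt_trans _) logm; rewrite ltnW // -(ltr_nat R) -(ltr_pM2l (ltr0n R 2)).
apply: logm.
rewrite [ltRHS]mulrC -ltr_pdivrMr // /log2 ltr_pdivlMr // -/c -ltr_expR lnK //.
by rewrite posrE (lt_trans (expR_gt0 c)).
Unshelve. all: by end_near. Qed.
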